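(* Let $A\ge p\ge q\ge r>0$ be rational with $p+q+r>A$. Consider the instance with four items given as (value, size): $$(A,3),\ (p,1),\ (q,1),\ (r,1),\qquad D=5,\ R=3.$$ Its raw profile at capacity $R$ at counts $0,1,2,3$ is $(0,A,p+q,p+q+r)$, and only the count-two point of this profile can fall below its upper concave hull. The instance realizes the pair $$H_w=(0,A,A+p,A+p+q),\qquad H_r=\left(0,A,\max\left\{p+q,\frac{A+p+q+r}{2}\right\},p+q+r\right);$$ that is, its hull at capacity $D$ is $H_w$ and its hull at capacity $R$ is $H_r$ ($H_r$ being the raw profile with its count-two point replaced by its hull value).
   Context: For an instance with items of rational value $a_i\ge0$ and positive integer size $d_i$ and integer capacities $0\le R<D$, let $U^w(n)$ (respectively $U^r(n)$) be the maximum total value of an $n$-element set of items of total size at most $D$ (respectively at most $R$), with value $-\infty$ if there is none, and $U^w(0)=U^r(0)=0$; these are the raw profiles at capacities $D$ and $R$. For $\alpha\in\{w,r\}$, the terminal count is $b_\alpha=\min\operatorname{arg\,max}_n U^\alpha(n)$, and the hull is the sequence on $\{0,\dots,b_\alpha\}$ obtained by evaluating at integers the upper concave hull of the points $(n,U^\alpha(n))$, $0\le n\le b_\alpha$. The instance realizes a pair $(H_w,H_r)$ of sequences on $\{0,\dots,b_w\}$, $\{0,\dots,b_r\}$ if its terminal counts are $b_w,b_r$ and its hulls are exactly $H_w$ (capacity $D$) and $H_r$ (capacity $R$). (The letter $r$ as a rational parameter is unrelated to the index $r$ in $H_r$, $U^r$, $b_r$.) *)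

(* Defs.v *)
From HB Require Import structures.
From mathcomp Require Import all_boot all_order all_algebra.
From mathcomp Require Import constructive_ereal.
Set Implicit Arguments.
Unset Strict Implicit.
Unset Printing Implicit Defensive.
Import Order.TTheory GRing.Theory Num.Theory.
Local Open Scope ring_scope.

(* Items are (value, size) pairs. They are identified by their position in the
   list, so that items with the same value and size remain distinct. *)
Record instance := Instance {
  items : seq (rat * nat);
  capD : nat;
  capR : nat
}.

Definition valid_instance (I : instance) : Prop :=
  (forall it : rat * nat, it \in items I -> 0 <= it.1 /\ (0 < it.2)%N) /\
  (capR I < capD I)%N.

Definition item (I : instance) (i : 'I_(size (items I))) : rat * nat :=
  tnth (in_tuple (items I)) i.

Definition set_value (I : instance) (S : {set 'I_(size (items I))}) : rat :=
  \sum_(i in S) (item i).1.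

Definition set_size (I : instance) (S : {set 'I_(size (items I))}) : nat :=
  (\sum_(i in S) (item i).2)%N.

(* The maximum over no set is -oo; at n = 0 only the empty set competes, which
   gives the value 0. *)
Definition raw_profile (I : instance) (c n : nat) : \bar rat :=
  \big[Order.max/-oo%E]_(S : {set 'I_(size (items I))} |
      (#|S| == n) && (set_size S <= c)%N) (set_value S)%:E.

Definition is_argmax (U : nat -> \bar rat) (n : nat) : Prop :=
  forall k : nat, (U k <= U n)%E.

Definition is_terminal_count (U : nat -> \bar rat) (b : nat) : Prop :=
  is_argmax U b /\ forall n : nat, is_argmax U n -> (b <= n)%N.

Definition barycentric (b : nat) (x : rat) (w : 'I_b.+1 -> rat) : Prop :=
  [/\ forall i, 0 <= w i, \sum_i w i = 1 & \sum_i w i * (i : nat)%:R = x].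

Definition combination (U : nat -> \bar rat) (b : nat) (w : 'I_b.+1 -> rat) :
    \bar rat :=
  (\sum_(i < b.+1) (w i)%:E * U i)%E.

(* y is the value at the abscissa x of the upper concave hull of the points
   (i, U i), 0 <= i <= b: the top of the slice at x of their convex hull.
   Points with U i = -oo are harmless, since 0 * -oo = 0 and a positive weight
   on such a point yields -oo. As the points and x are rational, rational
   weights attain the same maximum as real ones. *)
Definition is_hull_value (U : nat -> \bar rat) (b : nat) (x : rat)
    (y : \bar rat) : Prop :=
  (exists w : 'I_b.+1 -> rat, barycentric x w /\ y = combination U w) /\
  (forall w : 'I_b.+1 -> rat, barycentric x w -> (combination U w <= y)%E).

Definition is_hull (U : nat -> \bar rat) (b : nat) (H : b.+1.-tuple rat) : Prop :=
  forall n : 'I_b.+1, is_hull_value U b (n : nat)%:R (tnth H n)%:E.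

Definition below_hull (U : nat -> \bar rat) (n : nat) : Prop :=
  exists (b : nat) (y : \bar rat),
    [/\ is_terminal_count U b, (n <= b)%N, is_hull_value U b n%:R y
      & (U n < y)%E].

Definition realizes (I : instance) (bw br : nat)
    (Hw : bw.+1.-tuple rat) (Hr : br.+1.-tuple rat) : Prop :=
  [/\ is_terminal_count (raw_profile I (capD I)) bw,
      is_terminal_count (raw_profile I (capR I)) br,
      is_hull (raw_profile I (capD I)) Hw
    & is_hull (raw_profile I (capR I)) Hr].

Definition four_items (A p q r : rat) : instance :=
  {| items := [:: (A, 3%N); (p, 1%N); (q, 1%N); (r, 1%N)];
     capD := 5;
     capR := 3 |}.

(* Main.v *)
Require Import Defs.
From HB Require Import structures.
From mathcomp Require Import all_boot all_order all_algebra.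
From mathcomp Require Import constructive_ereal.
From mathcomp Require Import ring lra.
Set Implicit Arguments.
Unset Strict Implicit.
Unset Printing Implicit Defensive.
Import Order.TTheory GRing.Theory Num.Theory.
Local Open Scope ring_scope.

(** At capacity [5] the only infeasible set is the whole set, so the best [n]
items are the [n] most valuable ones, for [n <= 3]. At capacity [3] the
item of value [A] fills the knapsack: a feasible set is either that item alone
or a set of unit items, so the profile is [0, A, p + q, p + q + r]. Both
profiles are [-oo] beyond count three, and they have a strict maximum there
(this uses [A < p + q + r] at capacity [3]), which makes [3] the terminal
count.

The value of a hull at an abscissa is certified by an affine majorant of the
profile that touches it at two (possibly equal) counts whose segment contains
the abscissa ([is_hull_value_chord]). The profile at capacity [5] is concave, so
at every count it is touched by a majorant. At capacity [3] let [h] be the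
claimed hull value at count two. The line through the origin of slope [A]
certifies counts zero and one, and the line through [(2, h)] and
[(3, p + q + r)] certifies counts two and three: it touches the profile at
count two when [h = p + q], and otherwise it is the chord from count one to
count three, of which [h] is the midpoint. As the hull equals the profile at
counts zero, one and three, only count two can lie strictly below it. *)

(** * Terminal counts and hulls of a profile *)

Lemma is_terminal_count_uniq (U : nat -> \bar rat) (a b : nat) :
  is_terminal_count U a -> is_terminal_count U b -> a = b.
Proof.
by move=> [ma la] [mb lb]; apply/eqP; rewrite eqn_leq la // lb.
Qed.

Lemma is_terminal_count_strict (U : nat -> \bar rat) (b : nat) :
  (forall n, (n < b)%N -> (U n < U b)%E) ->
  (forall n, (b < n)%N -> U n = -oo%E) ->
  is_terminal_count U b.
Proof.
move=> lt_b gt_b; split=> [n|n maxn].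
  by case: (ltngtP n b) => [/lt_b/ltW|/gt_b->|->] //; rewrite leNye.
by rewrite leqNgt; apply/negP => /lt_b; rewrite ltNge maxn.
Qed.

Lemma sum_barycentric_affine (b : nat) (x c s : rat) (w : 'I_b.+1 -> rat) :
  barycentric x w -> \sum_i w i * (c + s * (i : nat)%:R) = c + s * x.
Proof.
move=> [_ w1 wx].
under eq_bigr => i _ do rewrite mulrDr mulrCA.
by rewrite big_split /= -mulr_suml -mulr_sumr w1 wx mul1r.
Qed.

Lemma combination_le_affine (U : nat -> \bar rat) (b : nat) (c s x : rat)
    (w : 'I_b.+1 -> rat) :
  (forall i : 'I_b.+1, (U i <= (c + s * (i : nat)%:R)%:E)%E) ->
  barycentric x w -> (combination U w <= (c + s * x)%:E)%E.
Proof.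
move=> leU bw; rewrite -(sum_barycentric_affine c s bw) -sumEFin.
apply: lee_sum => i _; rewrite EFinM; case: bw => w0 _ _.
by apply: lee_wpmul2l; rewrite ?lee_fin.
Qed.

Lemma sum_indicator (b : nat) (i : 'I_b.+1) (f : 'I_b.+1 -> rat) :
  \sum_k (k == i)%:R * f k = f i.
Proof.
under eq_bigr => k _ do rewrite mulr_natl mulrb.
by rewrite -big_mkcond big_pred1_eq.
Qed.

(** An affine majorant bounds every combination of the profile by its own value
at the barycentre, and the bound is attained by weights carried by counts where
the majorant touches the profile. *)
Lemma is_hull_value_chord (U : nat -> \bar rat) (b : nat) (c s t x : rat)
    (i j : 'I_b.+1) :
  (forall k : 'I_b.+1, (U k <= (c + s * (k : nat)%:R)%:E)%E) ->
  U i = (c + s * (i : nat)%:R)%:E -> U j = (c + s * (j : nat)%:R)%:E ->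
  0 <= t <= 1 -> x = t * (i : nat)%:R + (1 - t) * (j : nat)%:R ->
  is_hull_value U b x (c + s * x)%:E.
Proof.
move=> leU Ui Uj /andP[t0 t1] def_x.
split; last by move=> w; apply: combination_le_affine.
pose w (k : 'I_b.+1) : rat := t * (k == i)%:R + (1 - t) * (k == j)%:R.
have sum_w (f : 'I_b.+1 -> rat) : \sum_k w k * f k = t * f i + (1 - t) * f j.
  under eq_bigr => k _ do rewrite mulrDl -!mulrA.
  by rewrite big_split /= -!mulr_sumr !sum_indicator.
have bw : barycentric x w.
  split; last by rewrite def_x sum_w.
    by move=> k; rewrite addr_ge0 // mulr_ge0 // subr_ge0.
  under eq_bigr => k _ do rewrite -[w k]mulr1.
  by rewrite sum_w !mulr1 addrC subrK.
exists w; split=> //.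
rewrite -(sum_barycentric_affine c s bw) -sumEFin; apply: eq_bigr => k _.
rewrite /w; have [->|ki] := eqVneq k i; first by rewrite Ui EFinM.
have [->|kj] := eqVneq k j; first by rewrite Uj EFinM.
by rewrite !mulr0 addr0 mul0r mul0e.
Qed.

Lemma is_hull_value_touch (U : nat -> \bar rat) (b n : nat) (c s y : rat) :
  (forall k : 'I_b.+1, (U k <= (c + s * (k : nat)%:R)%:E)%E) ->
  (n < b.+1)%N -> U n = y%:E -> y = c + s * n%:R ->
  is_hull_value U b n%:R y%:E.
Proof.
move=> leU ltn + def_y; rewrite def_y => Un.
pose i := Ordinal ltn.
apply: (is_hull_value_chord (t := 1) (i := i) (j := i)) => //.
by rewrite subrr mul0r mul1r addr0.
Qed.

(** Although hull values are given by a relation, the value witnessing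
[below_hull] is a combination of the profile, hence at most the one in [H]. *)
Lemma below_hullP (U : nat -> \bar rat) (b : nat) (H : b.+1.-tuple rat)
    (n : nat) :
  is_terminal_count U b -> is_hull U H -> below_hull U n ->
  exists2 i : 'I_b.+1, n = i & (U i < (tnth H i)%:E)%E.
Proof.
move=> termb hullH [b' [y [termb' le_nb [[w [bw ->]] _] ltUy]]].
have eb := is_terminal_count_uniq termb' termb; subst b'.
exists (Ordinal (le_nb : (n < b.+1)%N)) => //.
apply: lt_le_trans ltUy _.
by have [_] := hullH (Ordinal (le_nb : (n < b.+1)%N)); apply.
Qed.

Lemma affine_majorant_upto3 (U : nat -> \bar rat) (u0 u1 u2 u3 c s : rat) :
  [/\ U 0%N = u0%:E, U 1%N = u1%:E, U 2%N = u2%:E & U 3%N = u3%:E] ->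
  [/\ u0 <= c, u1 <= c + s, u2 <= c + s * 2 & u3 <= c + s * 3] ->
  forall k : 'I_4, (U k <= (c + s * (k : nat)%:R)%:E)%E.
Proof.
move=> [U0 U1 U2 U3] [le0 le1 le2 le3] [[|[|[|[|k]]]] ltk] //.
- by rewrite U0 lee_fin mulr0 addr0.
- by rewrite U1 lee_fin mulr1.
- by rewrite U2 lee_fin.
- by rewrite U3 lee_fin.
Qed.

Lemma is_hull_upto3 (U : nat -> \bar rat) (h0 h1 h2 h3 : rat) :
  is_hull_value U 3 0%:R h0%:E -> is_hull_value U 3 1%:R h1%:E ->
  is_hull_value U 3 2%:R h2%:E -> is_hull_value U 3 3%:R h3%:E ->
  is_hull U [tuple h0; h1; h2; h3].
Proof.
by move=> ? ? ? ? [[|[|[|[|n]]]] ltn] //; rewrite (tnth_nth 0).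
Qed.

(** * Profiles of the four-item instance *)

Lemma raw_profile_eq (I : instance) (c n : nat) (v : rat)
    (S0 : {set 'I_(size (items I))}) :
  #|S0| = n -> (set_size S0 <= c)%N -> set_value S0 = v ->
  (forall S : {set 'I_(size (items I))},
     #|S| = n -> (set_size S <= c)%N -> set_value S <= v) ->
  raw_profile I c n = v%:E.
Proof.
move=> cS0 sS0 vS0 maxv; apply/eqP; rewrite eq_le; apply/andP; split.
  apply: bigmax_le; first exact: leNye.
  by move=> S /andP[/eqP cS sS]; rewrite lee_fin maxv.
rewrite -vS0; apply: (le_bigmax_cond _ (fun S => (set_value S)%:E)).
by rewrite cS0 eqxx.
Qed.

Lemma raw_profile_none (I : instance) (c n : nat) :
  (forall S : {set 'I_(size (items I))}, #|S| = n -> (c < set_size S)%N) ->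
  raw_profile I c n = -oo%E.
Proof.
move=> none; rewrite /raw_profile big_pred0 // => S.
by apply/negP => /andP[/eqP/none]; rewrite ltnNge => /negP.
Qed.

(** Encoding sets by four bits turns the optimisation over feasible sets into a
case analysis on booleans. *)
Definition select (a b c d : bool) : {set 'I_4} :=
  [set i : 'I_4 | nth false [:: a; b; c; d] i].

Lemma selectP (S : {set 'I_4}) : exists a b c d : bool, S = select a b c d.
Proof.
pose e k := (inord k : 'I_4) \in S.
exists (e 0), (e 1), (e 2), (e 3); apply/setP => i.
by rewrite inE -{1}(inord_val i); case: i => [[|[|[|[|i]]]] //].
Qed.

Lemma card_select (a b c d : bool) : #|select a b c d| = (a + b + c + d)%N.
Proof.
rewrite -sum1_card big_mkcond !big_ord_recl big_ord0 !inE /=.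
by case: a; case: b; case: c; case: d.
Qed.

Lemma set_size_select (A p q r : rat) (a b c d : bool) :
  @set_size (four_items A p q r) (select a b c d) = (3 * a + b + c + d)%N.
Proof.
rewrite /set_size big_mkcond !big_ord_recl big_ord0 !inE /=.
by case: a; case: b; case: c; case: d.
Qed.

Lemma set_value_select (A p q r : rat) (a b c d : bool) :
  @set_value (four_items A p q r) (select a b c d) =
    (if a then A else 0) + (if b then p else 0) + (if c then q else 0) +
      (if d then r else 0).
Proof.
rewrite /set_value big_mkcond !big_ord_recl big_ord0 !inE /=.
by rewrite addr0 !addrA.
Qed.

Lemma raw_profile_select (A p q r v : rat) (cap n : nat) (a b c d : bool) :
  (a + b + c + d = n)%N -> (3 * a + b + c + d <= cap)%N ->
  (if a then A else 0) + (if b then p else 0) + (if c then q else 0) +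
    (if d then r else 0) = v ->
  (forall a' b' c' d' : bool,
     (a' + b' + c' + d' = n)%N -> (3 * a' + b' + c' + d' <= cap)%N ->
     (if a' then A else 0) + (if b' then p else 0) + (if c' then q else 0) +
       (if d' then r else 0) <= v) ->
  raw_profile (four_items A p q r) cap n = v%:E.
Proof.
move=> cardn fits val_v maxv.
apply: (@raw_profile_eq (four_items A p q r) _ _ _ (select a b c d)).
- by rewrite card_select.
- by rewrite set_size_select.
- by rewrite set_value_select.
move=> S; have [a' [b' [c' [d' ->]]]] := selectP S.
by rewrite card_select set_size_select set_value_select; apply: maxv.
Qed.

(** A set of at least four items is the whole set, of size six. *)
Lemma raw_profile_four_items_none (A p q r : rat) (cap n : nat) :
  (cap <= 5)%N -> (3 < n)%N ->
  raw_profile (four_items A p q r) cap n = -oo%E.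
Proof.
move=> cap5 n3; apply: raw_profile_none => S cS.
apply: leq_ltn_trans cap5 _.
have [a [b [c [d ES]]]] := selectP S; move: cS n3; rewrite {}ES.
rewrite card_select set_size_select => <-.
by case: a; case: b; case: c; case: d.
Qed.

Lemma raw_profile_wide (A p q r : rat) :
  0 < r -> r <= q -> q <= p -> p <= A ->
  let I := four_items A p q r in
  [/\ raw_profile I 5 0 = 0%:E, raw_profile I 5 1 = A%:E,
      raw_profile I 5 2 = (A + p)%:E & raw_profile I 5 3 = (A + p + q)%:E].
Proof.
move=> hr hrq hqp hpA I; split.
- apply: (@raw_profile_select A p q r _ _ _ false false false false) => //.
  by do 4![case] => // _ _; cbv iota; lra.
- apply: (@raw_profile_select A p q r _ _ _ true false false false) => //.
    lra.
  by do 4![case] => // _ _; cbv iota; lra.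
- apply: (@raw_profile_select A p q r _ _ _ true true false false) => //.
    lra.
  by do 4![case] => // _ _; cbv iota; lra.
- apply: (@raw_profile_select A p q r _ _ _ true true true false) => //.
    lra.
  by do 4![case] => // _ _; cbv iota; lra.
Qed.

Lemma raw_profile_narrow (A p q r : rat) :
  0 < r -> r <= q -> q <= p -> p <= A ->
  let I := four_items A p q r in
  [/\ raw_profile I 3 0 = 0%:E, raw_profile I 3 1 = A%:E,
      raw_profile I 3 2 = (p + q)%:E & raw_profile I 3 3 = (p + q + r)%:E].
Proof.
move=> hr hrq hqp hpA I; split.
- apply: (@raw_profile_select A p q r _ _ _ false false false false) => //.
  by do 4![case] => // _ _; cbv iota; lra.
- apply: (@raw_profile_select A p q r _ _ _ true false false false) => //.
    lra.
  by do 4![case] => // _ _; cbv iota; lra.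
- apply: (@raw_profile_select A p q r _ _ _ false true true false) => //.
    lra.
  by do 4![case] => // _ _; cbv iota; lra.
- apply: (@raw_profile_select A p q r _ _ _ false true true true) => //.
    lra.
  by do 4![case] => // _ _; cbv iota; lra.
Qed.

(** * Hulls at the two capacities *)

(** The profile has slopes [A >= p >= q], so each of its points is touched by
the line prolonging an adjacent segment. *)
Lemma is_hull_wide (A p q r : rat) :
  0 < r -> r <= q -> q <= p -> p <= A ->
  is_hull (raw_profile (four_items A p q r) 5) [tuple 0; A; A + p; A + p + q].
Proof.
move=> hr hrq hqp hpA.
have prof := raw_profile_wide hr hrq hqp hpA.
have maj c s := affine_majorant_upto3 (c := c) (s := s) prof.
case: prof => U0 U1 U2 U3; apply: is_hull_upto3.
- apply: (is_hull_value_touch (n := 0) (maj 0 A _) isT U0).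
    by split; lra.
  lra.
- apply: (is_hull_value_touch (n := 1) (maj 0 A _) isT U1).
    by split; lra.
  lra.
- apply: (is_hull_value_touch (n := 2) (maj (A - p) p _) isT U2).
    by split; lra.
  lra.
- apply: (is_hull_value_touch (n := 3) (maj (A + p - 2 * q) q _) isT U3).
    by split; lra.
  lra.
Qed.

Lemma is_hull_narrow (A p q r : rat) :
  0 < r -> r <= q -> q <= p -> p <= A -> A < p + q + r ->
  is_hull (raw_profile (four_items A p q r) 3)
    [tuple 0; A; Num.max (p + q) ((A + p + q + r) / 2); p + q + r].
Proof.
move=> hr hrq hqp hpA hA.
have prof := raw_profile_narrow hr hrq hqp hpA.
have maj c s := affine_majorant_upto3 (c := c) (s := s) prof.
case: prof => U0 U1 U2 U3; apply: is_hull_upto3.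
- apply: (is_hull_value_touch (n := 0) (maj 0 A _) isT U0).
    by split; lra.
  lra.
- apply: (is_hull_value_touch (n := 1) (maj 0 A _) isT U1).
    by split; lra.
  lra.
- have [le_mid|lt_mid] := leP ((A + p + q + r) / 2) (p + q).
    apply: (is_hull_value_touch (n := 2) (maj (p + q - 2 * r) r _) isT U2).
      by split; lra.
    lra.
  pose s := (p + q + r - A) / 2.
  have -> : (A + p + q + r) / 2 = (A - s) + s * 2 by rewrite /s; lra.
  (* Here the hull value lies on the chord from count one to count three, which
     has slope [s]; count two is the midpoint, hence the weight [1 / 2]. *)
  apply: (is_hull_value_chord (t := 1 / 2)
            (i := @Ordinal 4 1 isT) (j := @Ordinal 4 3 isT)) => //.
  + by apply: maj; rewrite /s; split; lra.
  + by rewrite U1 mulr1 subrK.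
  + have last_on_line : p + q + r = A - s + s * 3%:R by rewrite /s; lra.
    by rewrite U3 last_on_line.
- (* The line of slope [s] through the last point is above the profile at count
     two when [s <= r] and at count one when [s <= (p + q + r - A) / 2]; the
     slope taken is the smaller of these bounds. *)
  have [le_mid|lt_mid] := leP ((A + p + q + r) / 2) (p + q).
    apply: (is_hull_value_touch (n := 3) (maj (p + q - 2 * r) r _) isT U3).
      by split; lra.
    lra.
  pose s := (p + q + r - A) / 2.
  apply: (is_hull_value_touch (n := 3) (maj (A - s) s _) isT U3).
    by rewrite /s; split; lra.
  rewrite /s; lra.
Qed.

Theorem theorem4p3 (A p q r : rat)
    (hr : 0 < r) (hrq : r <= q) (hqp : q <= p) (hpA : p <= A)
    (hA : A < p + q + r) :
  let I := four_items A p q r in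
  let Ur := raw_profile I (capR I) in
  [/\ valid_instance I,
      [/\ Ur 0%N = 0%:E, Ur 1%N = A%:E, Ur 2%N = (p + q)%:E
        & Ur 3%N = (p + q + r)%:E],
      forall n : nat, below_hull Ur n -> n = 2%N
    & realizes I
        [tuple 0; A; A + p; A + p + q]
        [tuple 0; A; Num.max (p + q) ((A + p + q + r) / 2); p + q + r]].
Proof.
move=> I Ur.
have profw := raw_profile_wide hr hrq hqp hpA.
have profr := raw_profile_narrow hr hrq hqp hpA.
have termw : is_terminal_count (raw_profile I (capD I)) 3.
  case: profw => U0 U1 U2 U3.
  apply: is_terminal_count_strict => [[|[|[|n]]] // _|n n3].
  - by rewrite U0 U3 lte_fin; lra.
  - by rewrite U1 U3 lte_fin; lra.
  - by rewrite U2 U3 lte_fin; lra.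
  exact: raw_profile_four_items_none.
have termr : is_terminal_count Ur 3.
  case: profr => U0 U1 U2 U3.
  apply: is_terminal_count_strict => [[|[|[|n]]] // _|n n3].
  - by rewrite /Ur U0 U3 lte_fin; lra.
  - by rewrite /Ur U1 U3 lte_fin; lra.
  - by rewrite /Ur U2 U3 lte_fin; lra.
  exact: raw_profile_four_items_none.
have hullr := is_hull_narrow hr hrq hqp hpA hA.
split=> //.
- split=> // it; rewrite !inE => /or4P[] /eqP-> /=; split=> //; lra.
- move=> n /(below_hullP termr hullr)[[[|[|[|[|k]]]] ltk] //= ->];
    case: profr => U0 U1 U2 U3; rewrite (tnth_nth 0) /Ur.
  + by rewrite U0 ltxx.
  + by rewrite U1 ltxx.
  + by rewrite U3 ltxx.
- by split=> //; apply: is_hull_wide.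
Qed.
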